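(* Suppose that $\liminf_{i\to\infty}q_i>0$, and that the replacement distributions $\boldsymbol\alpha^{(k)}$ on $\{1,\dots,k\}$, $k\ge1$, are such that there exist constants $N_1,N_2\ge1$ and $a>0$, independent of $k$, with $\sum_{j=1}^{\min\{N_1,k\}}\alpha_j^{(k)}\ge a$ for all $k\ge N_2$, where $N_1$ is such that either (a) $\tilde q_j<1$ for all $j\in\{1,\dots,N_1\}$, or (b) $\tilde q_j=1$ for all $j\in\{1,\dots,N_1\}$ and there is a path from any $j\in\{1,\dots,N_1\}$ to every type in $\mathcal S$. Suppose also that there exists $B_1<\infty$ such that $\mathbf E_i(|\boldsymbol Z_1|^2)<B_1$ for all $i\ge1$. If $\{\boldsymbol\alpha^{(k)}\}$ is such that there are constants $b,c$ with $0<b\le\bar v^{(k)}_i\le c<\infty$ for all $k\ge1$ and $1\le i\le k$, then $\liminf_{k\to\infty}\rho(\bar M^{(k)})>1$ implies $\sup_iq_i<1$.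
   Context: $\{\boldsymbol Z_n\}_{n\ge0}$ is a multitype Galton–Watson branching process with countably infinite type set $\mathcal S=\{1,2,3,\dots\}$, started from a single individual whose type is denoted $\varphi_0$. Each individual lives one generation and, at death, independently of all other individuals, an individual of type $i$ produces $\boldsymbol r=(r_1,r_2,\dots)$ offspring ($r_j$ of type $j$, finitely many $r_j$ nonzero) with probability $p_i(\boldsymbol r)$. $Z_{n,j}$ is the number of type-$j$ individuals in generation $n$ and $|\boldsymbol Z_n|=\sum_jZ_{n,j}$. Write $\mathbf P_i(\cdot)=\mathbf P(\cdot\mid\varphi_0=i)$, $\mathbf E_i(\cdot)=\mathbf E(\cdot\mid\varphi_0=i)$. The mean progeny matrix is $M=(M_{ij})$, where $M_{ij}$ is the expected number of type-$j$ children of a type-$i$ parent; its row sums are assumed finite. There is a path from $i$ to $j$ if there is a directed path from $i$ to $j$ in the graph on $\mathcal S$ with an edge $u\to v$ if and only if $M_{uv}>0$. Global and partial extinction probabilities: $q_i=\mathbf P_i(\lim_n|\boldsymbol Z_n|=0)$ and $\tilde q_i=\mathbf P_i(\forall l\ge1:\lim_nZ_{n,l}=0)$. Given $k\ge1$ and a probability distribution $\boldsymbol\alpha^{(k)}=(\alpha^{(k)}_1,\dots,\alpha^{(k)}_k)$ on $\{1,\dots,k\}$, consider the branching process $\{\bar{\boldsymbol Z}^{(k)}_n\}$ in which types in $\{1,\dots,k\}$ have the same progeny distribution as in $\{\boldsymbol Z_n\}$, except that every individual of type larger than $k$ is instantaneously, and independently of everything else, replaced by an individual whose type is drawn from $\boldsymbol\alpha^{(k)}$.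 Its $k\times k$ mean progeny matrix is $\bar M^{(k)}=\tilde M^{(k)}+\boldsymbol x^{(k)}\boldsymbol\alpha^{(k)}$, where $\tilde M^{(k)}=(M_{ij})_{1\le i,j\le k}$, $\boldsymbol x^{(k)}$ is the $k\times1$ vector with $x^{(k)}_i=\sum_{j>k}M_{ij}$, and $\boldsymbol\alpha^{(k)}$ is a row vector. $\rho(\bar M^{(k)})$ is its Perron–Frobenius eigenvalue (spectral radius), and $\bar{\boldsymbol v}^{(k)}=(\bar v^{(k)}_1,\dots,\bar v^{(k)}_k)^\top$ is a right Perron–Frobenius eigenvector: $\bar M^{(k)}\bar{\boldsymbol v}^{(k)}=\rho(\bar M^{(k)})\bar{\boldsymbol v}^{(k)}$ with all entries strictly positive (assumed to exist). *)

(* Defs.v *)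
From HB Require Import structures.
From mathcomp Require Import all_boot all_order all_algebra.
From mathcomp Require Import finmap multiset.
From mathcomp Require Import complex.
From mathcomp Require Import all_classical all_reals all_analysis.

Set Implicit Arguments.
Unset Strict Implicit.
Unset Printing Implicit Defensive.
Import Order.TTheory GRing.Theory Num.Theory.
Import numFieldNormedType.Exports.

Local Open Scope classical_set_scope.
Local Open Scope ring_scope.

(* The type set {1, 2, 3, ...} is nat with a shift: i : nat stands for type
   i + 1, so that the types {1, ..., k} are the i with i < k and the types
   larger than k are the i with k <= i. *)

(* A population, or the progeny r of an individual, is a finite multiset of
   types: z j is the number of individuals of type j, and size z their total
   number. *)
Notation population := {mset nat}%mset (only parsing).

Section Process.
Context {R : realType}.

(* p i r is the probability that an individual of type i has progeny r. *)
Definition progeny_law (p : nat -> population -> R) : Prop :=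
  forall i, (forall r, 0 <= p i r) /\
            (\esum_(r in [set: population]) (p i r)%:E = 1)%E.

(* Each progeny X j takes values in a countable set with its discrete
   sigma-algebra, so the events it generates are X j @^-1` A for all A. *)
Definition mutually_independent d (Omega : measurableType d)
    (P : probability Omega R) (I : choiceType)
    (X : I -> Omega -> population) : Prop :=
  forall (J : {fset I}) (A : I -> set population),
    P (\bigcap_(j in [set` J]) (X j @^-1` A j)) =
    (\prod_(j <- J) P (X j @^-1` A j))%E.

(* xi (n, j, m) is the progeny of the m-th individual of type j in
   generation n; it is used only when m is smaller than the number of such
   individuals. *)
Fixpoint Z (Omega : Type) (phi0 : Omega -> nat)
    (xi : nat * nat * nat -> Omega -> population) (n : nat) (w : Omega) :
    population :=
  if n is n'.+1 then
    let z := Z phi0 xi n' w in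
    \big[@msetD nat/mset0]_(j <- finsupp z)
      \big[@msetD nat/mset0]_(m < z j) xi (n', j, m : nat) w
  else [mset phi0 w]%mset.

(* P i is the law of the process started from one individual of type i. *)
Record branching_process (p : nat -> population -> R) d
    (Omega : measurableType d) (P : nat -> probability Omega R)
    (phi0 : Omega -> nat) (xi : nat * nat * nat -> Omega -> population) :
    Prop := BranchingProcess {
  bp_law : progeny_law p;
  bp_meas_phi0 : forall A : set nat, measurable (phi0 @^-1` A);
  bp_meas_xi : forall u (A : set population), measurable (xi u @^-1` A);
  bp_init : forall i, P i (phi0 @^-1` [set i]) = 1%E;
  bp_progeny : forall i n j m r,
    P i (xi (n, j, m) @^-1` [set r]) = (p j r)%:E;
  bp_indep : forall i, mutually_independent (P i) xi }.

Definition q d (Omega : measurableType d) (P : nat -> probability Omega R)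
    (phi0 : Omega -> nat) (xi : nat * nat * nat -> Omega -> population)
    (i : nat) : \bar R :=
  P i [set w | (fun n => size (Z phi0 xi n w)) @ \oo --> 0%N].

Definition q_partial d (Omega : measurableType d)
    (P : nat -> probability Omega R)
    (phi0 : Omega -> nat) (xi : nat * nat * nat -> Omega -> population)
    (i : nat) : \bar R :=
  P i [set w | forall l : nat, (fun n => Z phi0 xi n w l) @ \oo --> 0%N].

Definition M (p : nat -> population -> R) (i j : nat) : \bar R :=
  (\esum_(r in [set: population]) (p i r * (r j)%:R)%:E)%E.

Definition finite_row_sums (p : nat -> population -> R) : Prop :=
  forall i, (\sum_(0 <= j <oo) M p i j < +oo)%E.

(* The empty path connects i to itself. *)
Definition has_path (p : nat -> population -> R) (i j : nat) : Prop :=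
  exists2 s : seq nat, path (fun u v => 0 < M p u v)%E i s & last i s = j.

(* The use of fine is harmless when the row sums of M are finite. *)
Definition M_trunc (p : nat -> population -> R) (k : nat) : 'M[R]_k :=
  \matrix_(i < k, j < k) fine (M p i j).

Definition x_out (p : nat -> population -> R) (k : nat) : 'cV[R]_k :=
  \col_(i < k) fine (\sum_(k <= j <oo) M p i j)%E.

(* Mean progeny matrix of the process on the first k types in which each
   individual of a larger type is replaced by one with type drawn from
   alpha. *)
Definition Mbar (p : nat -> population -> R) (k : nat) (alpha : 'rV[R]_k) :
    'M[R]_k :=
  M_trunc p k + x_out p k *m alpha.

Definition distribution_on (k : nat) (alpha : 'rV[R]_k) : Prop :=
  (forall j, 0 <= alpha 0 j) /\ \sum_(j < k) alpha 0 j = 1.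

Definition spectral_radius (k : nat) (A : 'M[R]_k) : R :=
  sup [set complex.Re `|z| | z in
        [set z : R[i] | eigenvalue (map_mx (real_complex R) A) z]].

Definition PF_eigenvector (k : nat) (A : 'M[R]_k) (v : 'cV[R]_k) : Prop :=
  (forall i, 0 < v i 0) /\ A *m v = spectral_radius A *: v.

End Process.

(* Main.v *)
Require Import Defs.
From HB Require Import structures.
From mathcomp Require Import all_boot all_order all_algebra.
From mathcomp Require Import finmap multiset.
From mathcomp Require Import complex.
From mathcomp Require Import all_classical all_reals all_analysis.
From mathcomp Require Import measurable_realfun.
From mathcomp Require Import ring lra.

Set Implicit Arguments.
Unset Strict Implicit.
Unset Printing Implicit Defensive.
Import Order.TTheory GRing.Theory Num.Theory.
Import numFieldNormedType.Exports.

Local Open Scope classical_set_scope.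
Local Open Scope ring_scope.

(* Fix theta > 0 small.  The second moment bound gives
   G_i(1 - theta v) <= 1 - theta (Mbar v)_i + O(theta^2), so once the spectral
   radii stay above 1 + eta, the vector s^(k) equal to 1 - theta v^(k) on the
   first k types, and to 1 - theta (alpha^(k) v^(k)) on the others, satisfies
   G_i(s^(k)) <= s^(k)_i for i < k, with theta independent of k.  By Fatou the
   pointwise liminf l of the s^(k) satisfies G(l) <= l for every type, hence
   the product of l over the individuals of generation n is a supermartingale
   and q_i <= l_i <= 1 - theta b. *)

(** * Countable sums and integrals of discrete random variables *)

Lemma esumZl (R : realType) (T : choiceType) (I : set T) (c : R)
    (f : T -> \bar R) :
  0 <= c -> (forall i, 0 <= f i)%E ->
  (\esum_(i in I) (c%:E * f i) = c%:E * \esum_(i in I) f i)%E.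
Proof.
move=> c0 f0; rewrite /esum -ereal_supZl //; last first.
  by apply/set0P; exists 0%E, set0; [exact: fsets_set0|rewrite fsbig_set0].
rewrite image_comp; congr ereal_sup; apply: eq_imagel => A _ /=.
by rewrite ge0_mule_fsumr.
Qed.

Section DiscreteVariable.
Context d (Omega : measurableType d) (R : realType) (T : countType)
  (P : probability Omega R) (Y : Omega -> T).
Hypothesis mY : forall A, measurable (Y @^-1` A).
Local Open Scope ereal_scope.

Lemma measurable_fun_discrete (D : set Omega) (f : T -> \bar R) :
  measurable_fun D (fun w => f (Y w)).
Proof. by move=> mD B _; apply: measurableI => //; exact: (mY (f @^-1` B)). Qed.

(** Since [T] is countable, [choice.pickle] numbers its values, and E is the disjoint union of the
    events where Y has code n. Codes that no value attains give empty events. *)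
Lemma integral_discrete_partition (E : set Omega) (f : Omega -> \bar R) :
  measurable E -> measurable_fun E f -> (forall w, E w -> 0 <= f w) ->
  \int[P]_(w in E) f w =
  \esum_(t in [set: T]) \int[P]_(w in E `&` Y @^-1` [set t]) f w.
Proof.
move=> mE mf f0.
pose F n := E `&` Y @^-1` [set t | choice.pickle t = n].
have EF : E = \bigcup_n F n.
  apply/seteqP; split => [w Ew|w [n _ []]//].
  by exists (choice.pickle (Y w)).
have mF n : measurable (F n) by exact: measurableI.
rewrite [in LHS]EF ge0_integral_bigcup //; first last.
- move=> i j _ _ [w [[_ /= <-] [_ /= <-]]]; done.
- by rewrite -EF.
- by rewrite -EF.
rewrite nneseries_esumT; last first.
  by move=> n; apply: integral_ge0 => w [/f0].
rewrite (esumID (range (@choice.pickle T))); last first.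
  by move=> n _; apply: integral_ge0 => w [/f0].
rewrite [X in _ + X]esum1 ?adde0; last first.
  move=> n [_ /= nT]; rewrite (_ : F n = set0) ?integral_set0 //.
  by apply/seteqP; split => // w [_ /= Yn]; apply: nT; exists (Y w).
rewrite setTI esum_image; last first.
  by move=> s t _ _; exact: (pcan_inj choice.pickleK).
apply: eq_esum => t _; rewrite /F; congr (\int[P]_(w in E `&` _) _).
apply/seteqP; split => w /=; first exact: (pcan_inj choice.pickleK).
by move=> ->.
Qed.

Lemma measure_discrete_partition (E : set Omega) :
  measurable E -> P E = \esum_(t in [set: T]) P (E `&` Y @^-1` [set t]).
Proof.
move=> mE; rewrite -[LHS]mul1e -integral_cst // integral_discrete_partition //.
apply: eq_esum => t _; rewrite integral_cst ?mul1e //; last first.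
exact: measurableI.
Qed.

Lemma integral_discrete (E : set Omega) (f : T -> R) :
  measurable E -> (forall t, 0 <= f t)%R ->
  \int[P]_(w in E) (f (Y w))%:E =
  \esum_(t in [set: T]) ((f t)%:E * P (E `&` Y @^-1` [set t])).
Proof.
move=> mE f0; rewrite integral_discrete_partition //; last 2 first.
- exact: (measurable_fun_discrete (EFin \o f)).
- by move=> w _; rewrite lee_fin.
apply: eq_esum => t _; rewrite -integral_cst; last exact: measurableI.
by apply: eq_integral => w /set_mem[_ /= ->].
Qed.

End DiscreteVariable.

(** Lets the lemmas on big operators over a commutative monoid apply to sums of progenies. *)
HB.instance Definition _ (T : choiceType) :=
  Monoid.isComLaw.Build {mset T}%mset mset0 (@msetD T)
    (@msetDA T) (@msetDC T) (@mset0D T).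

(** * Events independent of part of a family of progenies *)

Section Independence.
Context d (Omega : measurableType d) (R : realType) (P : probability Omega R)
  (I : choiceType) (X : I -> Omega -> population).
Hypothesis mX : forall u (A : set population), measurable (X u @^-1` A).
Hypothesis indX : mutually_independent P X.
Local Open Scope ereal_scope.

(** As the [X u] are mutually independent, this is independence of E from the sigma-algebra
    generated by the [X u] with u in U. Testing finite cylinders only avoids constructing that
    sigma-algebra. *)
Definition independent_of (U : set I) (E : set Omega) : Prop :=
  measurable E /\
  forall (J : {fset I}) (A : I -> set population), [set` J] `<=` U ->
    P (E `&` \bigcap_(j in [set` J]) (X j @^-1` A j)) =
    P E * \prod_(j <- J) P (X j @^-1` A j).

Lemma sub_independent_of (U V : set I) (E : set Omega) :
  U `<=` V -> independent_of V E -> independent_of U E.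
Proof. by move=> UV [mE EV]; split=> // J A JU; apply: EV => j /JU/UV. Qed.

Lemma probability_setI1 (E C : set Omega) :
  measurable E -> measurable C -> P E = 1 -> P (E `&` C) = P C.
Proof.
move=> mE mC PE1.
have PE0 : P (~` E) = 0 by rewrite probability_setC // PE1 subee.
rewrite [RHS](measureDI P mC mE) [X in X + _](_ : _ = 0) ?add0e 1?setIC //.
apply/eqP; rewrite eq_le measure_ge0 andbT -PE0.
apply: le_measure; rewrite ?inE; last by move=> w [].
  exact: measurableD.
exact: measurableC.
Qed.

(** Starts the induction over generations, where the initial population is almost surely
    constant. *)
Lemma independent_of_trivial (U : set I) (E : set Omega) :
  measurable E -> P E = 1 \/ P E = 0 ->
  independent_of U E.
Proof.
move=> mE PE; split=> // J A _.
have mC : measurable (\bigcap_(j in [set` J]) (X j @^-1` A j)).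
  by rewrite bigcap_fset; apply: bigsetI_measurable.
rewrite -indX; case: PE => PE; first by rewrite PE mul1e probability_setI1.
rewrite PE mul0e; apply/eqP; rewrite eq_le measure_ge0 andbT -PE.
by apply: le_measure; rewrite ?inE //; exact: measurableI.
Qed.

(** Conditioning on one more progeny uses up its index u and keeps the remaining indices of U
    fresh. *)
Lemma independent_ofI (U : set I) (E : set Omega) (u : I)
    (B : set population) :
  independent_of U E -> U u ->
  P (E `&` X u @^-1` B) = P E * P (X u @^-1` B) /\
  independent_of (U `\ u) (E `&` X u @^-1` B).
Proof.
move=> [mE EU] Uu.
have PEB : P (E `&` X u @^-1` B) = P E * P (X u @^-1` B).
  have := EU [fset u]%fset (fun=> B).
  rewrite bigcap_fset !big_seq_fset1 => -> // j /=.
  by rewrite inE => /eqP ->.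
split=> //; split; first exact: measurableI.
move=> J A JU.
have uJ : u \notin J by apply/negP => /JU[_]; exact.
have JuU : [set` (u |` J)%fset] `<=` U.
  by move=> j /=; rewrite !inE => /orP[/eqP ->//|/JU[]].
(* The product rule for E is applied to J enlarged by u, with B at u and A elsewhere. *)
have := EU _ (fun j => if j == u then B else A j) JuU.
have ifA j : j \in J -> (if j == u then B else A j) = A j.
  by move=> jJ; case: eqP => // ju; rewrite -ju jJ in uJ.
rewrite bigcap_fset !big_fsetU1 //= eqxx setIA PEB muleA -bigcap_fset.
under eq_big_seq => j jJ do rewrite ifA //.
by under eq_bigcapr => j jJ do rewrite ifA //.
Qed.

(** Both sides of the product rule are countably additive over the pieces of E on which Y is
    constant, so the rule need only hold on each piece. *)
Lemma independent_of_partition (U : set I) (E : set Omega)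
    (T : countType) (Y : Omega -> T) :
  measurable E -> (forall A, measurable (Y @^-1` A)) ->
  (forall t, independent_of U (E `&` Y @^-1` [set t])) -> independent_of U E.
Proof.
move=> mE mY EYU; split=> // J A JU.
have mC : measurable (\bigcap_(j in [set` J]) (X j @^-1` A j)).
  by rewrite bigcap_fset; apply: bigsetI_measurable.
rewrite -indX (measure_discrete_partition P mY (measurableI _ _ mE mC)).
rewrite (measure_discrete_partition P mY mE) muleC.
have PfinC : P (\bigcap_(j in [set` J]) (X j @^-1` A j)) \is a fin_num.
  exact: fin_num_measure.
rewrite -(fineK PfinC) -esumZl ?fine_ge0 //.
apply: eq_esum => t _; rewrite fineK // muleC setIAC indX.
exact: (EYU t).2.
Qed.

Definition total (l : seq I) (w : Omega) : population :=
  \big[@msetD nat/mset0]_(u <- l) X u w.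

Lemma total_cons (u : I) (l : seq I) (w : Omega) :
  total (u :: l) w = (X u w `+` total l w)%mset.
Proof. exact: big_cons. Qed.

Lemma measurable_total (l : seq I) (A : set population) :
  measurable (total l @^-1` A).
Proof.
elim: l A => [|u l IHl] A.
  have [A0|A0] := pselect (A mset0).
    rewrite (_ : _ @^-1` _ = setT) //; apply/seteqP; split=> // w _.
    by rewrite /total /= big_nil.
  rewrite (_ : _ @^-1` _ = set0) //; apply/seteqP; split=> // w.
  by rewrite /total /= big_nil.
rewrite (_ : _ @^-1` _ = \bigcup_(r in [set: population])
   (X u @^-1` [set r] `&`
    total l @^-1` [set t | A (r `+` t)%mset])); last first.
  apply/seteqP; split=> w /=.
    by rewrite total_cons => Aw; exists (X u w).
  by move=> [r _ [<-]]; rewrite total_cons.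
apply: countable_bigcupT_measurable; first exact: countableP.
by move=> r; exact: measurableI.
Qed.

(** Induction on l: once the value r of the first progeny is fixed, the event only concerns the
    total of the others, and one index has been used up. *)
Lemma independent_of_total (U : set I) (l : seq I) (E : set Omega)
    (A : set population) :
  uniq l -> [set` l] `<=` U -> independent_of U E ->
  independent_of (U `\` [set` l]) (E `&` total l @^-1` A).
Proof.
elim: l U E A => [|u l IHl] U E A.
  move=> _ _ EU; have [A0|A0] := pselect (A mset0).
    rewrite (_ : _ `&` _ = E); first exact: sub_independent_of EU.
    by apply/seteqP; split=> w /=; rewrite /total big_nil // => -[].
  rewrite (_ : _ `&` _ = set0).
    by apply: independent_of_trivial => //; right; exact: measure0.
  by apply/seteqP; split=> w //=; rewrite /total big_nil // => -[].
move=> /= /andP[ul lu] ulU EU; have Uu : U u by apply: ulU; rewrite /= mem_head.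
apply: (@independent_of_partition _ _ _ (X u)) => [|//|r].
  by apply: measurableI; [exact: EU.1|exact: measurable_total].
rewrite (_ : _ `&` _ = (E `&` X u @^-1` [set r]) `&`
    total l @^-1` [set t | A (r `+` t)%mset]); last first.
  apply/seteqP; split=> w /=; rewrite total_cons.
    by move=> [[Ew Aw] ur]; rewrite -ur.
  by move=> [[Ew ur] Aw]; rewrite ur.
have [_ EuU] := independent_ofI [set r] EU Uu.
apply: sub_independent_of (IHl (U `\ u) _ _ lu _ EuU).
  move=> v [Uv]; rewrite /= inE => /negP.
  by rewrite negb_or => /andP[/eqP vu /negP vl].
move=> v vl; split; first by apply: ulU; rewrite /= inE vl orbT.
by move=> vu; move: vl ul => /=; rewrite vu => ->.
Qed.

(* The event E lets the induction on l condition on the first variable. *)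
Lemma integral_total_le (W : population -> R) (s : I -> R) (U : set I)
    (l : seq I) (E : set Omega) :
  (forall z, 0 <= W z)%R -> W mset0 = 1%R ->
  (forall y z, W (y `+` z)%mset = W y * W z)%R ->
  (forall u, 0 <= s u)%R ->
  (forall u, U u ->
    \esum_(r in [set: population]) ((W r)%:E * P (X u @^-1` [set r])) <=
    (s u)%:E) ->
  uniq l -> [set` l] `<=` U -> independent_of U E ->
  \int[P]_(w in E) (W (total l w))%:E <= P E * (\prod_(u <- l) s u)%:E.
Proof.
move=> W0 W1 WD s0 Ws; elim: l U Ws E => [|u l IHl] U Ws E.
  move=> _ _ [mE _]; rewrite big_nil mule1.
  under eq_integral do rewrite /total big_nil W1.
  by rewrite integral_cst // mul1e.
move=> /= /andP[ul lu] ulU EU; have Uu : U u by apply: ulU; rewrite /= mem_head.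
have mE := EU.1.
rewrite (@integral_discrete_partition _ _ _ _ P (X u)) //; last 2 first.
- exact: (measurable_fun_discrete (measurable_total (u :: l)) (EFin \o W)).
- by move=> w _; rewrite lee_fin.
set S := (\prod_(v <- l) s v)%R.
have S0 : (0 <= S)%R by exact: prodr_ge0.
have PEfin : P E \is a fin_num by exact: fin_num_measure.
have c0 : (0 <= fine (P E) * S)%R by rewrite mulr_ge0 // fine_ge0.
rewrite big_cons -/S mulrC EFinM muleA -[X in X * _ * _](fineK PEfin).
rewrite -[X in X * _]EFinM.
apply: le_trans (lee_wpmul2l _ (Ws u Uu)); rewrite ?lee_fin //.
rewrite -esumZl //; last by move=> r; rewrite mule_ge0 ?lee_fin.
apply: le_esum => r _.
have [PEu EuU] := independent_ofI [set r] EU Uu.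
rewrite (eq_integral (fun w => (W r)%:E * (W (total l w))%:E)); last first.
  by move=> w /set_mem[_ /= <-]; rewrite total_cons WD EFinM.
rewrite ge0_integralZl //; last 4 first.
- exact: EuU.1.
- exact: (measurable_fun_discrete (measurable_total l) (EFin \o W)).
- by move=> w _; rewrite lee_fin.
- by rewrite lee_fin.
apply: (@le_trans _ _ ((W r)%:E * (P (E `&` X u @^-1` [set r]) * S%:E))).
  apply: lee_wpmul2l; first by rewrite lee_fin.
  apply: (IHl (U `\ u)) => // [v [Uv _]|v vl]; first exact: Ws.
  split; first by apply: ulU; rewrite /= inE vl orbT.
  by move=> vu; move: vl ul => /=; rewrite vu => ->.
have Pufin : P (X u @^-1` [set r]) \is a fin_num by exact: fin_num_measure.
rewrite PEu -(fineK PEfin) -(fineK Pufin) -!EFinM lee_fin.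
by rewrite -subr_ge0 (_ : _ - _ = 0)%R //; ring.
Qed.

End Independence.

(** * Generations of the branching process *)

Section BranchingProcess.
Context (R : realType) d (Omega : measurableType d)
  (P : nat -> probability Omega R) (phi0 : Omega -> nat)
  (xi : nat * nat * nat -> Omega -> population) (p : nat -> population -> R).
Hypothesis bp : branching_process p P phi0 xi.

Let mxi := bp_meas_xi bp.
Let indxi i := bp_indep bp i.

(** The labels of the progenies that [Z] reads when generation n equals z; the next generation is
    their [total], over a list that depends on z alone. *)
Definition individuals (n : nat) (z : population) : seq (nat * nat * nat) :=
  [seq (n, j, m) | j <- finsupp z, m <- index_iota 0 (z j)].

Lemma uniq_individuals n z : uniq (individuals n z).
Proof.
apply: allpairs_uniq_dep => //; first by move=> j _; exact: iota_uniq.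
by move=> [j m] [j' m'] _ _ /= [-> ->].
Qed.

Lemma generation_individuals n z u : u \in individuals n z -> u.1.1 = n.
Proof. by case/allpairsPdep => j [m [_ _ ->]]. Qed.

Lemma ZS n w :
  Z phi0 xi n.+1 w = total xi (individuals n (Z phi0 xi n w)) w.
Proof.
rewrite /total /individuals big_allpairs_dep /=.
by apply: eq_bigr => j _; rewrite big_mkord.
Qed.

Lemma measurable_Z n (A : set population) : measurable (Z phi0 xi n @^-1` A).
Proof.
elim: n A => [|n IHn] A.
  exact: (bp_meas_phi0 bp [set j | A [mset j]%mset]).
rewrite (_ : _ @^-1` _ = \bigcup_(z in [set: population])
   (Z phi0 xi n @^-1` [set z] `&` total xi (individuals n z) @^-1` A)).
  apply: countable_bigcupT_measurable; first exact: countableP.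
  by move=> z; apply: measurableI => //; exact: measurable_total.
apply/seteqP; split=> w; rewrite /preimage /mkset ZS.
  by exists (Z phi0 xi n w).
by move=> [z _ [<-]].
Qed.

(** Generation n is a function of the initial type, which is almost surely i under [P i], and of
    progenies of earlier generations; those of generation n and later are still fresh. *)
Lemma independent_of_Z i n z :
  independent_of (P i) xi [set u | (n <= u.1.1)%N] (Z phi0 xi n @^-1` [set z]).
Proof.
elim: n z => [|n IHn] z.
  apply: independent_of_trivial => //; first exact: measurable_Z.
  have mi := bp_meas_phi0 bp [set i]; have Pi1 := bp_init bp i.
  have [->|iz] := eqVneq z [mset i]%mset; [left|right].
    rewrite -(probability_setI1 mi (measurable_Z _ _) Pi1) -Pi1; congr (P i _).
    by apply/seteqP; split=> w /=; [case|move=> ->].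
  rewrite -(probability_setI1 mi (measurable_Z _ _) Pi1) -(measure0 (P i)).
  congr (P i _); apply/seteqP; split=> w //= [-> zi].
  by rewrite -zi eqxx in iz.
apply: (@independent_of_partition _ _ _ _ _ _ _ _ _ _ _ (Z phi0 xi n)) => //.
- exact: measurable_Z.
- exact: measurable_Z.
(* With generation n fixed to y, generation n+1 is a total over a fixed list, whose labels all
   belong to generation n. *)
move=> y; rewrite (_ : _ `&` _ = Z phi0 xi n @^-1` [set y] `&`
    total xi (individuals n y) @^-1` [set z]); last first.
  by apply/seteqP; split=> w; rewrite /preimage /setI /mkset ZS => -[];
    [move=> + <-|move=> <-].
apply: sub_independent_of
  (independent_of_total mxi (indxi i) [set z] _ _ (IHn y)).
- move=> u /= nu; split; first exact: ltnW.
  by move=> /generation_individuals un; rewrite un ltnn in nu.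
- exact: uniq_individuals.
- by move=> u /generation_individuals /= ->.
Qed.

(** The monomial s^z; its mean under [p j] is the progeny generating function G_j(s). *)
Definition weight (s : nat -> R) (z : population) : R := \prod_(j <- z) s j.

Lemma weight0 s : weight s mset0 = 1.
Proof. by rewrite /weight big_mset0. Qed.

Lemma weightD s y z : weight s (y `+` z)%mset = weight s y * weight s z.
Proof.
rewrite /weight -big_cat; apply: perm_big; apply/allP => j _ /=.
by rewrite count_cat !count_mem_mset msetE2.
Qed.

Lemma weight_ge0 s z : (forall j, 0 <= s j) -> 0 <= weight s z.
Proof. by move=> s0; exact: prodr_ge0. Qed.

Lemma prod_individuals s n z :
  \prod_(u <- individuals n z) s u.1.2 = weight s z.
Proof.
rewrite /individuals big_allpairs_dep /weight big_mset.
by apply: eq_bigr => j _ /=; rewrite big_mkord prodr_const card_ord.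
Qed.

(** The componentwise inequality G(s) <= s. *)
Definition supersolution (s : nat -> R) : Prop :=
  forall j, (\esum_(r in [set: population]) ((weight s r)%:E * (p j r)%:E) <=
             (s j)%:E)%E.

(** * Supersolutions dominate extinction probabilities *)

Section Supersolution.
Variable s : nat -> R.
Hypotheses (s0 : forall j, 0 <= s j) (Gs : supersolution s).
Local Open Scope ereal_scope.

(** The weights of the generations form a supermartingale: given generation n equal to z, the fresh
    progenies contribute independent factors of mean at most s_j, one for each individual of z, so
    the mean weight of the next generation is at most s^z. *)
Lemma integral_weight_Z i n :
  \int[P i]_w (weight s (Z phi0 xi n w))%:E <= (s i)%:E.
Proof.
elim: n => [|n IHn].
  rewrite (eq_integral (fun w => (s (phi0 w))%:E)); last first.
    by move=> w _; rewrite /weight /= big_msetn.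
  rewrite (integral_discrete (P i) (bp_meas_phi0 bp)) //.
  (* Only the term of type i survives, since the initial type is almost surely i. *)
  rewrite (esumID [set i]); last by move=> *; rewrite mule_ge0 ?lee_fin.
  rewrite !setTI esum_set1 ?mule_ge0 ?lee_fin // [X in _ + X]esum1 ?adde0.
    by rewrite setTI (bp_init bp) mule1.
  move=> j /= /eqP ji; rewrite setTI -(probability_setI1 _ _ (bp_init bp i)) //;
    try exact: (bp_meas_phi0 bp).
  rewrite (_ : _ `&` _ = set0) ?measure0 ?mule0 //.
  by apply/seteqP; split=> w //= [-> /esym/eqP]; exact/negP.
have mW m (D : set Omega) :
    measurable_fun D (fun w => (weight s (Z phi0 xi m w))%:E).
  exact: (measurable_fun_discrete (@measurable_Z m) (EFin \o weight s)).
have W0 z : (0 <= weight s z)%R by exact: weight_ge0.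
apply: le_trans IHn; rewrite (integral_discrete (P i) (@measurable_Z n)) //.
rewrite (integral_discrete_partition (P i) (@measurable_Z n)) //; last first.
  by move=> w _; rewrite lee_fin.
apply: le_esum => z _; rewrite setTI.
rewrite (eq_integral
  (fun w => (weight s (total xi (individuals n z) w))%:E)); last first.
  by move=> w /set_mem <-; rewrite ZS.
(* The weight of z is rewritten as a product over labels, the shape of the bound for a total of
   independent progenies. *)
rewrite muleC -(prod_individuals s n z).
apply: (integral_total_le (s := fun u => s u.1.2) mxi W0 _ _ _ _ _ _
  (independent_of_Z i n z)) => //.
- exact: weight0.
- exact: weightD.
- move=> [[k j] m] _ /=; apply: le_trans (Gs j).
  by apply: le_esum => r _; rewrite (bp_progeny bp).
- exact: uniq_individuals.
- by move=> u /generation_individuals /= ->.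
Qed.

(** The empty population has weight 1 and every weight is nonnegative, so the mean weight bounds
    this probability. *)
Lemma measure_Z_mset0_le i n :
  P i (Z phi0 xi n @^-1` [set mset0]) <= (s i)%:E.
Proof.
apply: le_trans (integral_weight_Z i n).
have mE := @measurable_Z n [set mset0].
rewrite -[leLHS]mul1e -integral_cst //.
rewrite (eq_integral (fun w => (weight s (Z phi0 xi n w))%:E)); last first.
  by move=> w /set_mem /= ->; rewrite weight0.
apply: ge0_subset_integral => //.
  exact: (measurable_fun_discrete (@measurable_Z n) (EFin \o weight s)).
by move=> w _; rewrite lee_fin weight_ge0.
Qed.

Lemma q_le i : q P phi0 xi i <= (s i)%:E.
Proof.
(* [F n] says that all generations from n on are empty. These events increase with n by
   construction, and their union is extinction because a sequence of integers tends to 0 only if it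
   is eventually 0. *)
pose F n := \bigcap_(m in [set m | (n <= m)%N]) (Z phi0 xi m @^-1` [set mset0]).
have mF n : measurable (F n).
  by apply: bigcap_measurableType => m _; exact: measurable_Z.
have -> : q P phi0 xi i = P i (\bigcup_n F n).
  congr (P i _); apply/seteqP; split=> w /=.
    move=> /(_ [set 0%N]) [|n _ nw]; first exact: discrete_set1.
    exists n => // m /nw /= /eqP; rewrite size_mset_eq0 => /eqP; exact.
  move=> [n _ Fw]; apply: cvg_near_cst; exists n => // m /Fw /= ->.
  by rewrite size_mset0.
have mUF : measurable (\bigcup_n F n) by exact: bigcup_measurable.
have Fcvg : (P i \o F) @ \oo --> P i (\bigcup_n F n).
  apply: nondecreasing_cvg_mu => // m n mn; apply/subsetPset => w Fw k /= nk.
  by apply: Fw; exact: leq_trans nk.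
rewrite -(cvg_lim _ Fcvg) //; apply: lime_le.
  by apply/cvg_ex; exists (P i (\bigcup_n F n)); exact: Fcvg.
apply: nearW => n /=; apply: le_trans (measure_Z_mset0_le i n).
apply: le_measure; rewrite ?inE //; first exact: measurable_Z.
by move=> w Fw; exact: (Fw n (leqnn n)).
Qed.

End Supersolution.

(** Carries the moment bound from the process to [p i]: the integral is restricted to the event that
    the initial type is i, where the first generation is the single progeny [xi (0, i, 0)]. *)
Lemma second_moment_le (B : \bar R) i :
  ('E_(P i)[fun w => ((size (Z phi0 xi 1 w))%:R ^+ 2)%R] <= B)%E ->
  (\esum_(r in [set: population])
     (((size (r : population))%:R ^+ 2)%:E * (p i r)%:E) <= B)%E.
Proof.
apply: le_trans; rewrite expectation.unlock.
have mi := bp_meas_phi0 bp [set i].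
have -> : (\esum_(r in [set: population])
     (((size (r : population))%:R ^+ 2)%:E * (p i r)%:E) =
  \int[P i]_(w in phi0 @^-1` [set i])
     ((size (Z phi0 xi 1 w))%:R ^+ 2)%:E)%E.
  rewrite (eq_integral
    (fun w => ((size (xi (0, i, 0)%N w))%:R ^+ 2)%:E)); last first.
    move=> w /set_mem /= ->; rewrite finsupp_msetn big_seq_fset1 msetnxx.
    by rewrite big_ord1.
  rewrite (integral_discrete (P i) (mxi _)
    (f := fun r : population => (size r)%:R ^+ 2)) //.
  apply: eq_esum => r _.
  by rewrite probability_setI1 ?(bp_progeny bp) ?(bp_init bp).
apply: ge0_subset_integral => //.
  exact: (measurable_fun_discrete (@measurable_Z 1)
    (fun z : population => ((size z)%:R ^+ 2)%:E)).
Qed.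

End BranchingProcess.

(** * Second-order bound on the generating function *)

(** In the induction the bound for l is multiplied by 1 - x_i >= 0, and the cross term x_i s is
    absorbed by the square. The squared sum is what the second moment of the progeny controls. *)
Lemma prod_1subr_le (R : realDomainType) (T : Type) (l : seq T) (x : T -> R) :
  (forall i, 0 <= x i <= 1) ->
  \prod_(i <- l) (1 - x i) + \sum_(i <- l) x i <=
  1 + (\sum_(i <- l) x i) ^+ 2.
Proof.
move=> x01; elim: l => [|i l IHl]; first by rewrite !big_nil; lra.
have /andP[xi0 xi1] := x01 i; rewrite !big_cons.
have : 0 <= \sum_(j <- l) x j by apply: sumr_ge0 => j _; case/andP: (x01 j).
move: (\prod_(j <- l) _) (\sum_(j <- l) _) IHl => p s IHl s0.
have : (1 - x i) * p <= (1 - x i) * (1 + s ^+ 2 - s).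
  by apply: ler_wpM2l; lra.
by nra.
Qed.

(** Allows a cut to finitely many types before sums are exchanged; entries from n on are dropped. *)
Lemma sum_count_mem_le (R : numDomainType) (u : nat -> R) (n : nat)
    (l : seq nat) :
  (forall j, 0 <= u j) ->
  \sum_(0 <= j < n) (count_mem j l)%:R * u j <= \sum_(j <- l) u j.
Proof.
move=> u0; elim: l => [|x l IHl].
  by rewrite big_nil big1 // => j _; rewrite mul0r.
under eq_bigr do rewrite /= natrD mulrDl.
rewrite big_split big_cons /= lerD //.
have [xn|nx] := ltnP x n; last first.
  rewrite big_nat big1 // => j /andP[_ jn].
  by rewrite gtn_eqF ?mul0r //; exact: leq_trans nx.
rewrite (bigD1_seq x) /=; last 2 first.
  by rewrite mem_index_iota.
  exact: iota_uniq.
rewrite eqxx mul1r big1 ?addr0 // => j jx.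
by rewrite eq_sym (negbTE jx) mul0r.
Qed.

Section GeneratingFunction.
Context (R : realType) (p : nat -> population -> R).
Hypothesis plaw : progeny_law p.
Local Open Scope ereal_scope.

Let p0 i r : (0 <= p i r)%R. Proof. exact: (plaw i).1. Qed.

(** A pointwise bound on the weight of r is averaged over [p i]. The linear term stands on the left
    so that all sums have nonnegative terms. *)
Lemma generating_function_le (i : nat) (theta c B : R) (u : nat -> R) :
  (0 <= theta)%R -> (theta * c <= 1)%R -> (forall j, 0 <= u j <= c)%R ->
  \esum_(r in [set: population])
     (((size (r : population))%:R ^+ 2)%:E * (p i r)%:E) <= B%:E ->
  \esum_(r in [set: population])
     ((weight (fun j => 1 - theta * u j)%R r)%:E * (p i r)%:E) +
  theta%:E * \sum_(0 <= j <oo) (M p i j * (u j)%:E) <=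
  (1 + (theta * c) ^+ 2 * B)%:E.
Proof.
move=> th0 thc1 uc B2; set G := esum _ _.
have u0 j : (0 <= u j)%R by case/andP: (uc j).
have ux j : (0 <= theta * u j <= 1)%R.
  rewrite mulr_ge0 //= (le_trans _ thc1) // ler_wpM2l //.
  by case/andP: (uc j).
have W0 r : 0 <= (weight (fun j => 1 - theta * u j)%R r)%:E * (p i r)%:E.
  rewrite mule_ge0 ?lee_fin // weight_ge0 // => j.
  by rewrite subr_ge0; case/andP: (ux j).
have M0 j r : 0 <= (p i r * (r j)%:R)%:E by rewrite lee_fin mulr_ge0.
have uM0 j r : 0 <= (u j)%:E * (p i r * (r j)%:R)%:E.
  by rewrite mule_ge0 ?M0 // lee_fin.
have S0 r : 0 <= ((size (r : population))%:R ^+ 2)%:E * (p i r)%:E.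
  by rewrite mule_ge0 ?lee_fin ?sqr_ge0.
have M_ge0 j : 0 <= M p i j by apply: esum_ge0 => r _; exact: M0.
(* The product bound is used with x_j = theta u_j, whose sum over r is at most theta c times the
   size of r. *)
have weight_le r N : (weight (fun j => 1 - theta * u j) r +
    theta * \sum_(0 <= j < N) (r j)%:R * u j <=
    1 + (theta * c) ^+ 2 * (size (r : population))%:R ^+ 2)%R.
  apply: (@le_trans _ _ (\prod_(j <- (r : population)) (1 - theta * u j) +
      \sum_(j <- (r : population)) theta * u j)%R).
    rewrite lerD2l -mulr_sumr ler_wpM2l //.
    apply: le_trans (sum_count_mem_le N (r : population) u0).
    by apply: ler_sum => j _; rewrite count_mem_mset.
  apply: le_trans (prod_1subr_le _ ux) _; rewrite lerD2l -exprMn.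
  rewrite ler_sqr ?nnegrE; last 2 first.
  - by apply: sumr_ge0 => j _; case/andP: (ux j).
  - rewrite mulr_ge0 // mulr_ge0 // (le_trans (u0 0%N)) //.
    by case/andP: (uc 0%N).
  rewrite mulr_natr -[leRHS]addr0 -iter_addr -(count_predT r) -big_const_seq.
  apply: ler_sum => j _; rewrite ler_wpM2l //; by case/andP: (uc j).
have partial_le N :
    G + theta%:E * \sum_(0 <= j < N) (M p i j * (u j)%:E) <=
    (1 + (theta * c) ^+ 2 * B)%:E.
  under eq_bigr => j _ do rewrite muleC -esumZl //.
  rewrite -esum_sum; last by move=> *; exact: uM0.
  rewrite -esumZl //; last by move=> r; apply: sume_ge0 => *; exact: uM0.
  rewrite /G -esumD //; last first.
    move=> r _; rewrite mule_ge0 ?lee_fin //.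
    by apply: sume_ge0 => *; exact: uM0.
  apply: (@le_trans _ _ (\esum_(r in [set: population]) ((p i r)%:E +
     ((theta * c) ^+ 2)%:E *
     (((size (r : population))%:R ^+ 2)%:E * (p i r)%:E)))).
    apply: le_esum => r _; under eq_bigr do rewrite -EFinM.
    rewrite sumEFin -!EFinM -EFinD -EFinD lee_fin.
    have := ler_wpM2l ((plaw i).1 r) (weight_le r N).
    rewrite (_ : (\sum_(0 <= j < N) u j * _ =
        p i r * \sum_(0 <= j < N) (r j)%:R * u j)%R).
      by lra.
    by rewrite mulr_sumr; apply: eq_bigr => j _; ring.
  rewrite esumD //; last 2 first.
  - by move=> r _; rewrite lee_fin.
  - by move=> r _; rewrite mule_ge0 ?S0 // lee_fin sqr_ge0.
  rewrite (plaw i).2 esumZl ?sqr_ge0 // EFinD [X in _ <= _ + X]EFinM.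
  apply: leeD2l; apply: lee_wpmul2l => //.
  by rewrite lee_fin sqr_ge0.
have G0 : 0 <= G by apply: esum_ge0 => r _; exact: W0.
(* Finiteness of G, read off from the case of no types, lets G be moved across the inequality before
   N tends to infinity. *)
have Gfin : G \is a fin_num.
  rewrite ge0_fin_numE //; apply: le_lt_trans (ltry (1 + (theta * c) ^+ 2 * B)).
  by have := partial_le 0%N; rewrite big_geq // mule0 adde0.
rewrite -nneseriesZl; last by move=> j _; rewrite mule_ge0 ?lee_fin.
rewrite addeC -leeBrDr //; apply: lime_le.
  by apply: is_cvg_nneseries => j _ _; rewrite !mule_ge0 ?lee_fin.
apply: nearW => N; rewrite leeBrDr // addeC -ge0_sume_distrr //.
by move=> j _; rewrite mule_ge0 ?lee_fin.
Qed.

End GeneratingFunction.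

(** * Truncation with replacement, and passage to the limit *)

Section Truncation.
Context (R : realType) (p : nat -> population -> R).
Hypotheses (plaw : progeny_law p) (Mfin : finite_row_sums p).

(* An individual of type at least k is replaced by one with type drawn from
   alpha, so it is worth the mean of v under alpha. *)
Definition extension (k : nat) (alpha : 'rV[R]_k) (v : 'cV[R]_k) (j : nat) :
    R :=
  if insub j is Some i then v i 0 else (alpha *m v) 0 0.

Lemma extension_ord k (alpha : 'rV[R]_k) (v : 'cV[R]_k) (i : 'I_k) :
  extension alpha v i = v i 0.
Proof. by rewrite /extension valK. Qed.

Lemma extension_out k (alpha : 'rV[R]_k) (v : 'cV[R]_k) (j : nat) :
  (k <= j)%N -> extension alpha v j = (alpha *m v) 0 0.
Proof. by move=> kj; rewrite /extension insubN // -leqNgt. Qed.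

Lemma extension_bounds k (alpha : 'rV[R]_k) (v : 'cV[R]_k) (b c : R) :
  distribution_on alpha -> (forall i, b <= v i 0 <= c) ->
  forall j, b <= extension alpha v j <= c.
Proof.
move=> [alpha0 alpha1] vbc j; rewrite /extension; case: insub => // {j}.
rewrite mxE -[b]mul1r -[c]mul1r -alpha1 !mulr_suml.
apply/andP; split; apply: ler_sum => j _; apply: ler_wpM2l => //.
  by case/andP: (vbc j).
by case/andP: (vbc j).
Qed.

Lemma M_ge0 i j : (0 <= M p i j)%E.
Proof.
by apply: esum_ge0 => r _; rewrite lee_fin mulr_ge0 //; exact: (plaw i).1.
Qed.

(** All types from k on have the same value, so the tail of the row factors as [x_out] times the
    mean of v under alpha, which is the rank-one part of [Mbar]. *)
Lemma sum_M_extension k (alpha : 'rV[R]_k) (v : 'cV[R]_k) (i : 'I_k) :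
  (forall j, 0 <= extension alpha v j) ->
  (\sum_(0 <= j <oo) (M p i j * (extension alpha v j)%:E) =
   ((Mbar p alpha *m v) i 0)%:E)%E.
Proof.
move=> e0; rewrite (nneseries_split 0 k) ?add0n; last first.
  by move=> j _; rewrite mule_ge0 ?M_ge0 ?lee_fin.
(* Finite row sums make every [fine] in the definition of [Mbar] faithful. *)
have tail_fin N : (\sum_(N <= j <oo) M p i j)%E \is a fin_num.
  rewrite ge0_fin_numE; last by apply: nneseries_ge0 => *; exact: M_ge0.
  apply: le_lt_trans (Mfin i); rewrite (nneseries_split 0 N) ?add0n ?leeDr //.
    by apply: sume_ge0 => *; exact: M_ge0.
  by move=> *; exact: M_ge0.
have M_fin j : M p i j \is a fin_num.
  rewrite ge0_fin_numE ?M_ge0 //; apply: le_lt_trans (Mfin i).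
  rewrite (nneseriesD1 (n := j)) // ?leeDl //; last by move=> *; exact: M_ge0.
  by apply: nneseries_ge0 => *; exact: M_ge0.
have -> : (\sum_(k <= j <oo) (M p i j * (extension alpha v j)%:E) =
    (fine (\sum_(k <= j <oo) M p i j) * (alpha *m v) 0 0)%:E)%E.
  rewrite EFinM fineK // muleC -nneseriesZl; last by move=> *; exact: M_ge0.
  apply/congr_lim/eq_fun => n; apply: eq_big_nat => j /andP[kj _].
  by rewrite extension_out // muleC.
rewrite big_mkord /Mbar mulmxDl -mulmxA [in RHS]mxE EFinD.
congr (_ + _)%E; last first.
  by rewrite !mxE big_ord1 !mxE.
rewrite mxE -sumEFin; apply: eq_bigr => j _.
by rewrite extension_ord mxE EFinM fineK.
Qed.

(** The second-order bound is 1 - theta rho v_i + (theta c)^2 B. The error is at most theta (rho -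
    1) b, hence at most theta (rho - 1) v_i, which leaves 1 - theta v_i. *)
Lemma truncated_generating_function_le k (alpha : 'rV[R]_k) (v : 'cV[R]_k)
    (b c B rho theta : R) (i : 'I_k) :
  distribution_on alpha -> 0 <= b -> (forall j, b <= v j 0 <= c) ->
  Mbar p alpha *m v = rho *: v -> 1 <= rho -> 0 <= theta -> theta * c <= 1 ->
  theta * c ^+ 2 * B <= (rho - 1) * b ->
  (\esum_(r in [set: population])
     (((size (r : population))%:R ^+ 2)%:E * (p i r)%:E) <= B%:E)%E ->
  (\esum_(r in [set: population])
     ((weight (fun j => 1 - theta * extension alpha v j) r)%:E * (p i r)%:E) <=
   (1 - theta * extension alpha v i)%:E)%E.
Proof.
move=> alphaD b0 vbc Mv rho1 th0 thc small B2.
have ebc := extension_bounds alphaD vbc.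
have e0c j : 0 <= extension alpha v j <= c.
  by case/andP: (ebc j) => be ->; rewrite (le_trans b0 be).
have := generating_function_le plaw th0 thc e0c B2.
rewrite sum_M_extension; last by move=> j; case/andP: (e0c j).
rewrite Mv mxE extension_ord -leeBrDr // -!EFinB => /le_trans; apply.
rewrite lee_fin; case/andP: (vbc i) => bv _.
have : (rho - 1) * b <= (rho - 1) * v i 0 by rewrite ler_wpM2l // subr_ge0.
move=> /(le_trans small)/(ler_wpM2l th0); lra.
Qed.

(** Fatou's argument. The tail infima t_n increase to the liminf, and monotonicity of the weight
    bounds each finite part of G_j(t_n) by s_k(j) for every k >= n, hence by t_n(j), once n >= K.
    The threshold may depend on j. *)
Lemma supersolution_liminf (s : nat -> nat -> R) :
  (forall k j, 0 <= s k j <= 1) ->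
  (forall j, exists K, forall k, (K <= k)%N ->
     (\esum_(r in [set: population]) ((weight (s k) r)%:E * (p j r)%:E) <=
      (s k j)%:E)%E) ->
  supersolution p (fun j => sup (range (infs (s^~ j)))).
Proof.
move=> s01 Gs j; have [K GK] := Gs j.
pose t n i := infs (s^~ i) n; pose l i := sup (range (infs (s^~ i))).
have tl i : t ^~ i @ \oo --> l i.
  apply: cvg_infs_sup; [exists 1|exists 0] => _ [k _ <-].
    by case/andP: (s01 k i).
  by case/andP: (s01 k i).
have lbs n i : has_lbound (sdrop (s^~ i) n).
  by exists 0 => _ [k _ <-]; case/andP: (s01 k i).
have t0 n i : 0 <= t n i.
  apply: lb_le_inf; first by exists (s n i), n => /=.
  by move=> _ [k _ <-]; case/andP: (s01 k i).
have ts n k i : (n <= k)%N -> t n i <= s k i.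
  by move=> nk; apply: ge_inf => //; exists k.
have weight_cvg r : weight (t n) r @[n --> \oo] --> weight l r.
  by apply: cvg_big => //; exact: mul_continuous.
(* Only finite sums over r need a bound, and these are continuous in finitely many coordinates. *)
apply: ub_ereal_sup => _ [F [finF _] <-].
rewrite fsbig_finite //=.
under eq_bigr do rewrite -EFinM.
rewrite sumEFin lee_fin.
apply: (@ler_cvg_to _ (@nbhs _ _ \oo) _ _
  (fun n => \sum_(r <- fset_set F) weight (t n) r * p j r) (t ^~ j)).
- apply: cvg_big => [|r _]; first exact: add_continuous.
  by apply: cvgMl; exact: weight_cvg.
- exact: tl.
exists K => // n /= Kn; apply: lb_le_inf; first by exists (s n j), n => /=.
move=> _ [k /= nk <-]; rewrite -lee_fin.
apply: le_trans (GK k (leq_trans Kn nk)).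
apply: esum_ge; exists F => //.
rewrite fsbig_finite //= -sumEFin; apply: lee_sum => r _.
rewrite -EFinM lee_fin ler_wpM2r //; first exact: (plaw j).1.
by apply: ler_prod => i _; rewrite t0 ts.
Qed.

End Truncation.

(** * Choice of a uniform theta and conclusion *)

Lemma limn_einf_gt1 (R : realType) (x : nat -> R) :
  (1 < limn_einf (fun k => (x k)%:E))%E ->
  exists2 eta : R, 0 < eta & exists K, forall k, (K <= k)%N -> 1 + eta <= x k.
Proof.
rewrite limn_einf_lim (cvg_lim _ (@cvg_einfs_sup _ _)) //.
move=> /ereal_sup_gt[_ [n _ <-]].
have le_x k : (n <= k)%N -> (einfs (fun k => (x k)%:E) n <= (x k)%:E)%E.
  by move=> nk; apply: ereal_inf_lbound; exists k.
(* A tail infimum above 1 is a real number y, since it is at most x_n; y - 1 is the margin. *)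
case: (einfs _ n) le_x => [y| |] le_x y1 //; last by have := le_x n (leqnn n).
exists (y - 1); first by rewrite subr_gt0 -lte_fin.
by exists n => k /le_x; rewrite lee_fin addrC subrK.
Qed.

Theorem corollary4 (R : realType) (d : measure_display)
    (Omega : measurableType d) (P : nat -> probability Omega R)
    (phi0 : Omega -> nat) (xi : nat * nat * nat -> Omega -> population)
    (p : nat -> population -> R)
    (alpha : forall k : nat, 'rV[R]_k) (v : forall k : nat, 'cV[R]_k)
    (N1 N2 : nat) (a B1 b c : R) :
  branching_process p P phi0 xi ->
  finite_row_sums p ->
  (0 < limn_einf (q P phi0 xi))%E ->
  (forall k, (0 < k)%N -> distribution_on (alpha k)) ->
  (1 <= N1)%N -> (1 <= N2)%N -> 0 < a ->
  (forall k, (N2 <= k)%N -> a <= \sum_(j < k | (j < N1)%N) alpha k 0 j) ->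
  (forall j, (j < N1)%N -> (q_partial P phi0 xi j < 1)%E) \/
  (forall j, (j < N1)%N ->
     q_partial P phi0 xi j = 1%E /\ forall l, has_path p j l) ->
  (forall i, ('E_(P i)[fun w => ((size (Z phi0 xi 1 w))%:R ^+ 2)%R] < B1%:E)%E) ->
  (forall k, (0 < k)%N -> PF_eigenvector (Mbar p (alpha k)) (v k)) ->
  0 < b ->
  (forall k (i : 'I_k), b <= v k i 0 <= c) ->
  (1 < limn_einf (fun k => (spectral_radius (Mbar p (alpha k)))%:E))%E ->
  (ereal_sup (range (q P phi0 xi)) < 1)%E.
Proof.
move=> bp Mfin _ alphaD _ _ _ _ _ second_moment PF b0 vbc rho_gt1.
have plaw := bp_law bp.
have B2 i := second_moment_le bp (ltW (second_moment i)).
have B10 : 0 <= B1.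
  rewrite -lee_fin; apply: le_trans (B2 0%N); apply: esum_ge0 => r _.
  by rewrite mule_ge0 // lee_fin ?sqr_ge0 //; exact: (plaw 0%N).1.
have bc : b <= c.
  by have /andP[] := vbc 1%N 0; exact: le_trans.
have c0 : 0 < c by exact: lt_le_trans bc.
have [eta eta0 [K rhoK]] := limn_einf_gt1 rho_gt1.
(* D dominates both c^2 B1 and eta b c, so theta = eta b / D meets the two smallness conditions. *)
pose D := c ^+ 2 * B1 + eta * b * c + 1.
have etab0 : 0 < eta * b by rewrite mulr_gt0.
have D0 : 0 < D.
  by rewrite ltr_wpDl // addr_ge0 ?mulr_ge0 ?sqr_ge0 // ltW.
pose theta := eta * b / D.
have th0 : 0 < theta by rewrite divr_gt0.
have thc : theta * c <= 1.
  rewrite /theta mulrAC ler_pdivrMr // mul1r /D.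
  have : 0 <= c ^+ 2 * B1 by rewrite mulr_ge0 ?sqr_ge0.
  lra.
have small : theta * c ^+ 2 * B1 <= eta * b.
  rewrite /theta -mulrA mulrAC ler_pdivrMr // ler_wpM2l ?ltW // /D.
  have : 0 <= eta * b * c by rewrite mulr_ge0 ?ltW.
  lra.
pose u k := extension (alpha k) (v k).
pose s k j := 1 - theta * u k j.
have ubc k j : (0 < k)%N -> b <= u k j <= c.
  by move=> k0; apply: extension_bounds; [exact: alphaD|exact: vbc].
have u0c k j : 0 <= u k j <= c.
  (* For k = 0 the extension is an empty sum, equal to 0: the lower bound b is lost, but s stays in
     [0, 1]. *)
  case: k => [|k]; last first.
    by have /andP[bu ->] := ubc k.+1 j isT; rewrite (le_trans (ltW b0)).
  by rewrite /u /extension insubN // mxE big_ord0 lexx ltW.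
have s01 k j : 0 <= s k j <= 1.
  have /andP[u0 uc] := u0c k j.
  rewrite subr_ge0 gerBl; apply/andP; split; last by rewrite mulr_ge0 // ltW.
  by apply: le_trans thc; rewrite ler_wpM2l // ltW.
pose l j := sup (range (infs (s^~ j))).
have lbs n i : has_lbound (sdrop (s^~ i) n).
  by exists 0 => _ [k _ <-]; case/andP: (s01 k i).
have ls n j : infs (s^~ j) n <= 1 - theta * b.
  (* The index n+1 lies in the tail and is positive, so the lower bound b is available. *)
  apply: (@le_trans _ _ (s n.+1 j)).
    by apply: ge_inf => //; exists n.+1 => /=.
  by rewrite lerD2l lerN2 ler_pM2l //; case/andP: (ubc n.+1 j isT).
have l_le j : l j <= 1 - theta * b.
  by apply: ge_sup; [exists (infs (s^~ j) 0%N), 0%N|move=> _ [n _ <-]].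
have l0 j : 0 <= l j.
  apply: (@le_trans _ _ (infs (s^~ j) 0%N)).
    apply: lb_le_inf; first by exists (s 0%N j), 0%N => /=.
    by move=> _ [k _ <-]; case/andP: (s01 k j).
  by apply: ub_le_sup; [exists (1 - theta * b) => _ [n _ <-]|exists 0%N].
have Gl : supersolution p l.
  (* From this threshold on, the spectral radius is at least 1 + eta and j is one of the first k
     types. *)
  apply: supersolution_liminf => // j; exists (maxn K j.+1) => k.
  rewrite geq_max => /andP[Kk jk].
  have k0 : (0 < k)%N by exact: leq_ltn_trans jk.
  have rho1 : 1 + eta <= spectral_radius (Mbar p (alpha k)) by exact: rhoK.
  apply: (truncated_generating_function_le plaw Mfin (i := Ordinal jk)
    (alphaD k k0) (ltW b0) (vbc k) (PF k k0).2 _ (ltW th0) thc _ (B2 j)).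
    lra.
  apply: le_trans small _; rewrite (ler_wpM2r (ltW b0)) //; lra.
apply: (@le_lt_trans _ _ (1 - theta * b)%:E); last first.
  by rewrite lte_fin gtrBl mulr_gt0.
apply: ub_ereal_sup => _ [i _ <-].
by apply: le_trans (q_le bp l0 Gl i) _; rewrite lee_fin.
Qed.
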